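(* Let $\mathbf G=\{G_1,G_2,\ldots\}$ be a countable family of countable sets satisfying conditions (g$_1$) and (g$_2$) of the context, let $\mathbf G_1\subseteq\mathbf G$ be an arbitrary subfamily, and let $\mathcal V$ be a normal conic subset of $\mathcal W$. Then $$\operatorname{ex}\bigl(\mathcal S^{\mathbf G_1}\cap\mathcal V\bigr)=\mathcal P^{\mathbf G_1}\cap\mathcal V .$$
   Context: $\mathbf G=\{G_1,G_2,\ldots\}$ is a (finite or infinite) countable family of countable sets, which may have non-empty intersections. $G$ is the simple graph whose vertex set is $\bigcup_kG_k$, two distinct vertices being joined by an edge if and only if they belong to the same set $G_k$ for some $k$. $\mathcal W$ is the linear space of real-valued functions on the vertex set of $G$; elements $w\ge 0$ of $\mathcal W$ are called weights. For $\mathbf G_1\subseteq\mathbf G$, $\mathcal S^{\mathbf G_1}$ is the set of all non-negative $w\in\mathcal W$ such that $\sum_{g\in G_k}w(g)\le1$ for every $G_k\in\mathbf G$ and $\sum_{g\in G_k}w(g)=1$ for every $G_k\in\mathbf G_1$. $\mathcal P^{\mathbf G_1}$ is the set of those $w\in\mathcal S^{\mathbf G_1}$ which take only the values $0$ and $1$. A path $g_0\to g_1\to\dots\to g_l$ in $G$ is a sequence of vertices in which consecutive vertices are joined by an edge. A path is a cycle if $g_0=g_l$ and the number of distinct vertices $g_j$ is at least $3$. A path is admissible if no three adjacent (i.e. consecutive) vertices of it belong to the same set $G_k$; for a cycle $g_0\to\dots\to g_l=g_0$ adjacency is understood cyclically (so the triple $g_{l-1},g_0,g_1$ is included), and its number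 of vertices is $l$. Conditions: (g$_1$) every vertex of $G$ belongs to at most two of the sets $G_k$; (g$_2$) every admissible cycle in $G$ has an even number of vertices. A subset $\mathcal V\subseteq\mathcal W$ is normal if $\tilde w\in\mathcal V$ whenever $\tilde w\in\mathcal W$ and there is $w\in\mathcal V$ with $|\tilde w(g)|\le|w(g)|$ for all $g$. It is conic if it is closed under multiplication by positive scalars. $\operatorname{ex}\Omega$ is the set of extreme points of $\Omega$, i.e. of elements of $\Omega$ which are not convex linear combinations of two other elements of $\Omega$. *)

(* Defs.v *)
From HB Require Import structures.
From mathcomp Require Import all_boot all_order all_algebra.
From mathcomp Require Import all_classical all_reals esum.

Set Implicit Arguments.
Unset Strict Implicit.
Unset Printing Implicit Defensive.

Import Order.TTheory GRing.Theory Num.Theory.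

Local Open Scope classical_set_scope.
Local Open Scope ring_scope.

(* A family of sets is a set of subsets of an ambient type [T], so its members
   are pairwise distinct; they may overlap, and some may be empty. *)
Section Graph.
Context {T : choiceType}.
Implicit Type GG : set (set T).

Definition vertices GG : set T := \bigcup_(A in GG) A.

Definition edge GG : rel T :=
  fun x y => (x != y) && `[< exists2 A, GG A & A x /\ A y >].

(* The list [s] of vertices of a path has no three consecutive entries in one
   member of the family.  The condition concerns positions, not distinct
   vertices: a backtracking x, y, x along an edge is not admissible. *)
Definition admissible GG (s : seq T) : Prop :=
  forall (A : set T) (x y z : T), GG A -> infix [:: x; y; z] s ->
    ~ [/\ A x, A y & A z].

(* A cycle g_0 -> ... -> g_l = g_0 is given by [c = [:: g_0; ...; g_(l-1)]], so
   that its number of vertices l is [size c]; [path.cycle] includes the closing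
   edge from g_(l-1) to g_0.  Vertices may be repeated. *)
Definition is_cycle GG (c : seq T) : Prop :=
  path.cycle (edge GG) c /\ (3 <= size (undup c))%N.

(* Appending g_0, g_1 to [c] produces exactly the cyclically consecutive
   triples. *)
Definition admissible_cycle GG (c : seq T) : Prop :=
  is_cycle GG c /\ admissible GG (c ++ take 2 c).

Definition cond_g1 GG : Prop :=
  forall x, vertices GG x -> ([set A | GG A /\ A x] #<= `I_2)%card.

Definition cond_g2 GG : Prop :=
  forall c : seq T, admissible_cycle GG c -> ~~ odd (size c).

End Graph.

(* Real functions on the vertex set, which is viewed as a type (the subtype of
   [T] carved out by [vertices GG]); [R^o] makes this a vector space over [R]. *)
Definition fun_space (R : realType) (T : choiceType) (GG : set (set T)) :=
  set_type (vertices GG) -> R^o.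

Section Polytopes.
Context {R : realType} {T : choiceType} {GG : set (set T)}.
Local Notation W := (fun_space R GG).

(* [esum] is the supremum of the finite partial sums, i.e. the unordered sum,
   when the summands are non-negative. *)
Definition sum_over (A : set T) (w : W) : \bar R :=
  \esum_(v in [set v : set_type (vertices GG) | A (val v)]) (w v)%:E.

Definition stable (GG1 : set (set T)) : set W :=
  [set w | [/\ forall v, 0 <= w v,
               forall A, GG A -> (sum_over A w <= 1)%E &
               forall A, GG1 A -> sum_over A w = 1%E]].

Definition stable01 (GG1 : set (set T)) : set W :=
  [set w | stable GG1 w /\ forall v, w v = 0 \/ w v = 1].

Definition normal_set (V : set W) : Prop :=
  forall w' w : W, V w -> (forall v, `|w' v| <= `|w v|) -> V w'.

End Polytopes.

Arguments stable R {T} GG GG1 _.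
Arguments stable01 R {T} GG GG1 _.

Section Convexity.
Context {R : realType} {M : lmodType R}.

Definition conic_set (V : set M) : Prop :=
  forall (a : R) (w : M), 0 < a -> V w -> V (a *: w).

Definition extreme_points (Omega : set M) : set M :=
  [set x | Omega x /\
    ~ exists y z : M, exists t : R,
        [/\ Omega y /\ y <> x, Omega z /\ z <> x, 0 <= t <= 1 &
            x = t *: y + (1 - t) *: z]].

End Convexity.

(* Main.v *)
Require Import Defs.
From HB Require Import structures.
From mathcomp Require Import all_boot all_order all_algebra.
From mathcomp Require Import all_classical all_reals ereal esum.
From mathcomp Require Import zify ring lra.

(** Regard the members of the family as nodes and the vertices of the graph as
    edges: by the first condition a vertex is an edge joining the two members
    that contain it, or an edge with a loose end at the only one.  A function of
    the polytope is then a fractional matching, and the second condition plays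
    the role of bipartiteness.

    Functions with values 0 and 1 are extreme because every function of the
    polytope takes its values in the interval from 0 to 1
    ([extreme_stable01]).  Conversely, if [w] takes a value strictly between 0
    and 1 at some vertex [r], a non-zero [eta] is constructed such that both
    [w + eta] and [w - eta] are in the polytope and [|eta| <= w]
    ([exists_balanced]).  The last spread_bound gives [|w + eta| <= 2 w], so
    that a normal conic set containing [w] contains both functions, and [w] is
    their midpoint.  Two constructions of [eta] are needed; they only involve
    vertices where [w] is positive.

    - If two such vertices lie in the same two members, or if there is an
      admissible cycle of such vertices without repetition, then [eta] is a
      small constant with alternating signs along that closed sequence.  Its sum
      over every member is 0, because an admissible cycle has even length
      ([alternating_balanced], [alternating_count_cycle]).

    - Otherwise the vertices that can be reached from [r] form a tree.  In terms
      of the distance to [r], each member contains a single vertex closest to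
      [r] ([min_level_unique]) and each vertex other than [r] has a single
      neighbour closer to [r] ([parent_unique]); a violation would close up to
      an admissible cycle without repetition ([no_arc]).  Write [eta = f w],
      start with [f r = 1] and let [f] take, at all other vertices of a member
      whose closest vertex is [p], the constant value
      [- f p * w p / (1 - w p)].  With this choice the change of the sum over a
      member is a bounded multiple of the slack in the constraint, so it is 0 at
      the tight members and harmless, after scaling, at all others.  The factor [f]
      stays bounded even along infinitely many steps: neighbours [p] and [q]
      satisfy [w p + w q <= 1], so the product of two consecutive ratios
      [w p / (1 - w p)] and [w q / (1 - w q)] is at most 1
      ([spread_le], [spread_balanced]). *)

Set Implicit Arguments.
Unset Strict Implicit.
Unset Printing Implicit Defensive.

Import Order.TTheory GRing.Theory Num.Theory.

Local Open Scope classical_set_scope.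
Local Open Scope ring_scope.

(** * Admissible paths *)

Section Combinatorics.
Context {T : choiceType} (GG : set (set T)).
Implicit Types (x y z a b c : T) (s : seq T) (A B : set T).

Definition common_member x y z := exists2 A, GG A & [/\ A x, A y & A z].

Lemma admissible_triple s a b c l :
  admissible GG (s ++ [:: a, b, c & l]) -> ~ common_member a b c.
Proof.
move=> adm [A GA Aabc]; apply: (adm A a b c GA) Aabc.
by apply/infixP; exists s, l.
Qed.

Lemma admissible_catl s1 s2 : admissible GG (s1 ++ s2) -> admissible GG s2.
Proof.
move=> adm A x y z GA inf; apply: adm GA _.
exact/(infix_trans inf)/suffix_infix.
Qed.

Lemma admissible_rev s : admissible GG s -> admissible GG (rev s).
Proof.
move=> adm A x y z GA; rewrite -infix_rev revK => /(adm A z y x GA) nA.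
by move=> [Ax Ay Az]; apply: nA.
Qed.

Lemma admissible_cons a b c s :
  ~ common_member a b c -> admissible GG [:: b, c & s] ->
  admissible GG [:: a, b, c & s].
Proof.
move=> nabc adm A x y z GA; rewrite infix_consl => /orP[|]; last exact: adm.
move=> /prefixP[s' [ax bY cz _]] Axyz; subst.
by apply: nabc; exists A.
Qed.

Lemma admissible_rcons s a b c :
  ~ common_member a b c -> admissible GG (s ++ [:: a; b]) ->
  admissible GG (s ++ [:: a; b; c]).
Proof.
move=> nabc /admissible_rev; rewrite rev_cat => adm.
rewrite -[_ ++ _]revK; apply: admissible_rev; rewrite rev_cat /=.
rewrite /rev/= in adm *.
apply: admissible_cons => //; apply: contra_not nabc => -[A GA [*]].
by exists A.
Qed.

Lemma edgeP x y :
  reflect (x <> y /\ exists2 A, GG A & A x /\ A y) (edge GG x y).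
Proof.
apply: (iffP andP) => [[/eqP ? /asboolP ?]//|[/eqP ? ?]].
by split=> //; apply/asboolP.
Qed.

Lemma edge_sym : symmetric (edge GG).
Proof.
by move=> x y; apply/edgeP/edgeP => -[nxy [A GA [Ax Ay]]]; split;
  [exact/nesym|exists A|exact/nesym|exists A].
Qed.

Lemma edge_vertex x y : edge GG x y -> vertices GG y.
Proof. by case/edgeP=> _ [A GA []] *; exists A. Qed.

End Combinatorics.

(** * Distance from a root in a graph without cycles *)

Section Levels.
Context {T : choiceType} (GG : set (set T)) (pos : T -> Prop) (r : T).
Implicit Types (x y z p : T) (s c : seq T) (A B : set T).
Hypothesis posr : pos r.
(** Two distinct vertices in the same two members would form a closed trail of
    length 2, which the definition of a cycle does not cover. *)
Hypothesis noparallel : forall A B x y, GG A -> GG B -> x <> y ->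
  pos x -> pos y -> A x -> A y -> B x -> B y -> A = B.
Hypothesis nocycle : forall c, uniq c -> (forall x, x \in c -> pos x) ->
  ~ admissible_cycle GG c.

Fixpoint walk n x : Prop :=
  if n is n'.+1 then exists2 y, walk n' y & edge GG y x /\ pos x else x = r.

Definition level n x := walk n x /\ forall m, (m < n)%N -> ~ walk m x.

Lemma walk_pos n x : walk n x -> pos x.
Proof. by case: n => [->//|n [y _ []]]. Qed.

Lemma level_pos n x : level n x -> pos x.
Proof. by case=> /walk_pos. Qed.

Lemma walk_level n x : walk n x -> exists2 m, (m <= n)%N & level m x.
Proof.
elim/ltn_ind: n => n IH wx.
have [[m mn wm]|nw] := pselect (exists2 m, (m < n)%N & walk m x).
  by have [k km lk] := IH _ mn wm; exists k => //; lia.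
by exists n => //; split=> // m mn wm; apply: nw; exists m.
Qed.

Lemma level_inj m n x : level m x -> level n x -> m = n.
Proof.
move=> [wm lm] [wn ln]; case: (ltngtP m n) => // h.
  by case: (ln _ h).
by case: (lm _ h).
Qed.

Lemma level_parent n x : level n.+1 x -> exists2 y, level n y & edge GG y x.
Proof.
move=> [[y wy [yx px]] lx]; exists y => //; split=> // m mn wm.
by apply: (lx m.+1) => //=; exists y.
Qed.

Lemma level_edge m n x y : level m x -> level n y -> edge GG x y -> (n <= m.+1)%N.
Proof.
move=> [wx _] ly xy; rewrite leqNgt; apply/negP => mn.
apply: (ly.2 _ mn); exists x => //; split=> //; exact: level_pos ly.
Qed.

Lemma level_reach m x y : level m x -> edge GG x y -> pos y ->
  exists2 n, (n <= m.+1)%N & level n y.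
Proof. by move=> [wx _] xy py; apply: walk_level; exists x. Qed.

(** The vertices of a member are pairwise adjacent, so their levels differ by at
    most 1. *)
Lemma level_member m n A x y : GG A -> A x -> A y ->
  level m x -> level n y -> (n <= m.+1)%N.
Proof.
move=> GA Ax Ay lx ly; have [xy|xy] := pselect (x = y).
  by rewrite xy in lx; rewrite (level_inj lx ly).
by apply: level_edge lx ly _; apply/edgeP; split=> //; exists A.
Qed.

(** The sequence [s] is an arc from [x] to [y], all of it at distance at least [k]
    from the root and with both ends at distance exactly [k].  Prolonging both
    ends by their parents gives an arc of the same kind one level closer to the
    root, so the two parents must coincide at some level, at the latest at the
    root; the arc then closes to a cycle, either directly from [y] to [x] when the
    common parent shares a member with both, or through that parent.  The last two
    hypotheses say that the members used by the first and the last edge of the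
    arc contain no vertex closer to the root; they make the prolonged or closed
    sequence admissible at its junctions. *)
Lemma no_arc k s x x1 l t y1 y :
  s = [:: x, x1 & l] -> s = t ++ [:: y1; y] ->
  x <> y -> level k x -> level k y ->
  (forall z, z \in s -> exists2 j, (k <= j)%N & level j z) ->
  uniq s -> path.sorted (edge GG) s -> admissible GG s ->
  (forall j p, (j < k)%N -> level j p -> ~ common_member GG p x x1) ->
  (forall j p, (j < k)%N -> level j p -> ~ common_member GG y1 y p) ->
  False.
Proof.
elim: k s x x1 l t y1 y => [|k IH] s x x1 l t y1 y sl sr xy lx ly ls us es adm Ix Iy.
  by case: lx ly => [/= xr _] [/= yr _]; case: xy; rewrite xr.
have [x' lx' xx'] := level_parent lx.
have [y' ly' yy'] := level_parent ly.
have lowNs z : level k z -> z \notin s.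
  by move=> lz; apply/negP => /ls[j kj lj]; have := level_inj lz lj; lia.
have px := level_pos lx; have py := level_pos ly.
have poss z : z \in s -> pos z by move=> /ls[j _ /level_pos].
(* Distinct parents prolong the arc. *)
have [exy|nxy] := pselect (x' = y'); last first.
  apply: (IH (x' :: s ++ [:: y']) x' x (x1 :: l ++ [:: y']) (x' :: t ++ [:: y1]) y y') => //.
  - by rewrite sl.
  - by rewrite sr /= -!catA.
  - move=> z; rewrite inE mem_cat inE => /or3P[/eqP->|/ls[j]|/eqP->];
      by [exists k|exists j => //; lia].
  - rewrite /= cat_uniq us/= mem_cat inE !negb_or !lowNs//= !andbT.
    exact/eqP.
  - rewrite sl /= xx'/= -[_ && _]/(path (edge GG) x ((x1 :: l) ++ [:: y'])).
    rewrite cat_path/=; move: es; rewrite sl /= => ->/=.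
    have -> : last x1 l = y by rewrite -[LHS]/(last x (x :: x1 :: l)) -sl sr last_cat.
    by rewrite edge_sym yy'.
  - have : admissible GG (s ++ [:: y']).
      rewrite sr -catA; apply: admissible_rcons; first exact: Iy ly'.
      by rewrite -sr.
    by rewrite sl; apply: admissible_cons; apply: Ix lx'.
  - move=> j p jk lp [A GA [Ap _ Ax]].
    by have := level_member GA Ap Ax lp lx; lia.
  - move=> j p jk lp [A GA [Ay _ Ap]].
    by have := level_member GA Ap Ay lp ly; lia.
subst y'.
have lastx a : last a s = y by rewrite sr last_cat.
have pathx : path (edge GG) x (x1 :: l) by move: es; rewrite sl.
have Ix' := Ix _ _ (ltnSn k) lx'.
have Iy' := Iy _ _ (ltnSn k) lx'.
(* If no member contains the common parent and both ends, then the parent belongs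
   to the cycle; otherwise it must be left out, and [x] and [y] are adjacent. *)
have [[D GD [Dy Dz Dx]]|nD] := pselect (common_member GG y x' x); last first.
  apply: (nocycle (c := x' :: s)).
  - by rewrite /= us lowNs.
  - by move=> z; rewrite inE => /predU1P[->|/poss//]; apply: level_pos lx'.
  split; [split|].
  - rewrite /= rcons_path lastx edge_sym yy' andbT sl/=.
    by rewrite xx'/= in pathx *.
  - rewrite undup_id ?sl//=; move: (lowNs _ lx') us; rewrite sl /= => -> /=.
    by [].
  - rewrite [in take 2 _]sl /=.
    have -> : x' :: s ++ [:: x'; x] = (x' :: t ++ [:: y1]) ++ [:: y; x'; x].
      by rewrite sr /= -!catA.
    apply: admissible_rcons => //.
    have -> : (x' :: t ++ [:: y1]) ++ [:: y; x'] = (x' :: t) ++ [:: y1; y; x'].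
      by rewrite /= -!catA.
    apply: admissible_rcons => //.
    by rewrite /= -sr sl; apply: admissible_cons; rewrite -?sl.
apply: (nocycle us poss); split; [split|].
- rewrite sl [path.cycle _ _](rcons_path _ _ (x1 :: l)) pathx /=.
  have -> : last x1 l = y by rewrite -(lastx x) sl.
  by apply/edgeP; split; [exact/nesym|exists D].
- rewrite undup_id// sl/=; case: l => [|//] in sl Ix pathx *.
  have y1E : y1 = x /\ y = x1.
    move: sr; rewrite sl; case: t => [[-> ->]//|a [|b t]//=].
    by move=> [_ _]; case: t.
  by case: Iy'; exists D => //; rewrite y1E.1.
(* A member containing [x], [y] and the next vertex of the arc can only be [D],
   which contains the parent, against the hypotheses on the end edges. *)
- have DP E : GG E -> E y -> E x -> E = D.
    by move=> GE Ey Ex; apply: (noparallel (x := x) (y := y)).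
  rewrite [in take 2 _]sl /= take0 sr -catA.
  have -> : t ++ [:: y1; y] ++ [:: x; x1] = (t ++ [:: y1]) ++ [:: y; x; x1].
    by rewrite -!catA.
  apply: admissible_rcons.
    move=> [E GE [Ey Ex Ex1]]; rewrite (DP E) // in Ex1.
    by apply: Ix'; exists D.
  rewrite -catA; apply: admissible_rcons; last by rewrite -sr.
  move=> [E GE [Ey1 Ey Ex]]; rewrite (DP E) // in Ey1.
  by apply: Iy'; exists D.
Qed.

(** Two vertices of a member that both minimize the distance to the root form an
    arc by themselves. *)
Lemma min_level_unique k A x y : GG A -> A x -> A y -> level k x -> level k y ->
  (forall j p, (j < k)%N -> level j p -> ~ A p) -> x = y.
Proof.
move=> GA Ax Ay lx ly low; apply: contrapT => nxy.
have lowxy j p : (j < k)%N -> level j p -> forall E, GG E -> E x -> E y -> ~ E p.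
  move=> jk lp E GE Ex Ey; rewrite (noparallel (A := E) (B := A) (x := x) (y := y)) //.
  - exact: low lp.
  - exact: level_pos lx.
  - exact: level_pos ly.
apply: (@no_arc k [:: x; y] x y [::] [::] x y) => //.
- by move=> z; rewrite !inE => /orP[] /eqP ->; exists k.
- by rewrite /= inE andbT; apply/eqP.
- by rewrite /= andbT; apply/edgeP; split=> //; exists A.
- by move=> E a b c _ /size_infix.
- by move=> j p jk lp [E GE [Ep Ex Ey]]; exact: (lowxy _ _ jk lp _ GE Ex Ey).
- by move=> j p jk lp [E GE [Ex Ey Ep]]; exact: (lowxy _ _ jk lp _ GE Ex Ey).
Qed.

(** Two parents [p], [q] of [g] would give the arc [p, g, q], or two closest
    vertices in a member containing all three. *)
Lemma parent_unique k g p q : level k.+1 g -> level k p -> level k q ->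
  edge GG p g -> edge GG q g -> p = q.
Proof.
move=> lg lp lq pg qg; apply: contrapT => npq.
have low j E z : (j < k)%N -> GG E -> E g -> level j z -> ~ E z.
  by move=> jk GE Eg lz Ez; have := level_member GE Ez Eg lz lg; lia.
have [[A GA [Ap Ag Aq]]|ntri] := pselect (common_member GG p g q).
  by apply: npq; apply: (min_level_unique GA Ap Aq lp lq) => j z jk; apply: low jk GA Ag.
apply: (@no_arc k [:: p; g; q] p g [:: q] [:: p] g q) => //.
- by move=> z; rewrite !inE => /or3P[] /eqP ->; [exists k|exists k.+1|exists k].
- rewrite /= !inE negb_or andbT; move: pg qg => /edgeP[npg _] /edgeP[nqg _].
  by rewrite !(introN eqP) //; apply/nesym.
- by rewrite /= pg edge_sym qg.
- by apply: admissible_cons => // E a b c _ /size_infix.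
- by move=> j z jk lz [E GE [Ez Ep Eg]]; exact: (low _ _ _ jk GE Eg lz Ez).
- by move=> j z jk lz [E GE [Eg Ep Ez]]; exact: (low _ _ _ jk GE Eg lz Ez).
Qed.

End Levels.

(** * Unordered sums of non-negative functions *)

Section Sums.
Context {R : realType} {T : choiceType}.
Implicit Types (x y p : T) (s c : seq T) (A : set T) (u v : T -> R).

Lemma le_esumZ A u k : 0 < k -> (forall x, 0 <= u x) ->
  (\esum_(x in A) (k * u x)%:E <= k%:E * \esum_(x in A) (u x)%:E)%E.
Proof.
move=> k0 u0; apply: ge_ereal_sup => _ [X XA <-].
under eq_fsbigr do rewrite EFinM.
rewrite -ge0_mule_fsumr; last by move=> x; rewrite lee_fin.
by rewrite lee_pmul2l//; apply: esum_ge; exists X.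
Qed.

Lemma esumZ A u k : 0 <= k -> (forall x, 0 <= u x) ->
  (\esum_(x in A) (k * u x)%:E = k%:E * \esum_(x in A) (u x)%:E)%E.
Proof.
rewrite le_eqVlt => /predU1P[<-|k0] u0.
  by rewrite mul0e esum1// => x _; rewrite mul0r.
apply/eqP; rewrite eq_le le_esumZ//=.
have ki0 : 0 < k^-1 by rewrite invr_gt0.
rewrite -(@lee_pmul2l _ k^-1%:E)// muleA -EFinM mulVf ?gt_eqF// mul1e.
have := @le_esumZ A (fun x => k * u x) k^-1 ki0.
under eq_esum do rewrite mulrA mulVf ?gt_eqF// mul1r.
by apply=> x; rewrite mulr_ge0// ltW.
Qed.

Lemma esum_pick A p u : A p -> (forall x, 0 <= u x) ->
  (\esum_(x in A) (u x)%:E =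
    (u p)%:E + \esum_(x in A `&` ~` [set p]) (u x)%:E)%E.
Proof.
move=> Ap u0; rewrite (esumID [set p]); last by move=> x _; rewrite lee_fin.
by rewrite setIidr ?esum_set1 ?lee_fin ?u0// => x ->.
Qed.

(** In the tree construction [p] is the vertex of [A] closest to the root and the
    other vertices share one factor; [k = 1] gives one step of [esum_change]. *)
Lemma esum_affine A p u v k S : A p ->
  (forall x, 0 <= u x) -> (forall x, 0 <= v x) -> 0 <= k ->
  (\esum_(x in A) (u x)%:E = S%:E)%E ->
  (forall x, A x -> x <> p -> v x = k * u x) ->
  (\esum_(x in A) (v x)%:E = (k * (S - u p) + v p)%:E)%E.
Proof.
move=> Ap u0 v0 k0 uS vu.
have := esum_pick Ap u0; rewrite (esum_pick Ap v0) uS.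
rewrite [in X in _ -> X](eq_esum (b := fun x => (k * u x)%:E)); last first.
  by move=> x [Ax /= xp]; rewrite vu.
rewrite esumZ//.
have : (0%:E <= \esum_(x in A `&` ~` [set p]) (u x)%:E)%E.
  by apply: esum_ge0 => x _; rewrite lee_fin.
case: (\esum_(_ in _) _)%E => [s| |] //= s0 [->].
by rewrite -EFinM -EFinD; congr EFin; ring.
Qed.

Lemma esum_ge_pair A x y u : A x -> A y -> x <> y -> (forall z, 0 <= u z) ->
  ((u x + u y)%:E <= \esum_(z in A) (u z)%:E)%E.
Proof.
move=> Ax Ay xy u0; rewrite (esum_pick Ax u0) EFinD leeD2l//.
rewrite (esum_pick (p := y))//; last by split=> // /nesym.
by rewrite leeDl// esum_ge0// => z _; rewrite lee_fin.
Qed.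

(** The terms are changed one at a time. *)
Lemma esum_change A c u v S : uniq c ->
  (forall x, 0 <= u x) -> (forall x, 0 <= v x) ->
  (forall x, x \notin c -> v x = u x) ->
  (\esum_(x in A) (u x)%:E = S%:E)%E ->
  (\esum_(x in A) (v x)%:E = (S + \sum_(x <- c | x \in A) (v x - u x))%:E)%E.
Proof.
move=> + u0; elim: c v => [|p c IH] v /=.
  move=> _ v0 vu uS; rewrite big_nil addr0 -uS; apply: eq_esum => x _.
  by rewrite vu.
move=> /andP[pc uc] v0 vu uS.
pose v' x := if x == p then u x else v x.
have v'0 x : 0 <= v' x by rewrite /v'; case: eqP.
have v'S : (\esum_(x in A) (v' x)%:E =
    (S + \sum_(x <- c | x \in A) (v x - u x))%:E)%E.
  rewrite (IH v' uc v'0)//; last first.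
    move=> x xc; rewrite /v'; case: eqVneq => // xp.
    by apply: vu; rewrite inE negb_or xp.
  congr (_ + _)%:E; rewrite [LHS]big_seq_cond [RHS]big_seq_cond.
  apply: eq_bigr => x /andP[xc _]; rewrite /v' ifN//.
  by apply: contraNneq pc => <-.
rewrite big_cons; case: ifPn => [|]; rewrite ?inE ?notin_setE => Ap; last first.
  rewrite -v'S; apply: eq_esum => x Ax; rewrite /v' ifN//.
  by apply/eqP => xp; apply: Ap; rewrite -xp.
rewrite (esum_affine Ap v'0 v0 ler01 v'S).
  by rewrite /v' eqxx; congr EFin; ring.
by move=> x _ /eqP xp; rewrite /v' (negbTE xp) mul1r.
Qed.

End Sums.

(** * Alternating sums along cycles *)

Section Alternating.
Context {R : realType} {T : choiceType} (GG : set (set T)).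
Implicit Types (x y z p : T) (s c : seq T) (A B D : set T).

(** The form in which the condition on at most two members is used. *)
Lemma two_members x A B D : cond_g1 GG -> GG A -> GG B -> GG D ->
  A x -> B x -> D x -> A <> B -> D = A \/ D = B.
Proof.
move=> g1 GA GB GD Ax Bx Dx nAB.
have /g1/pcard_leP/injfunPex[f fI0 finj0] : vertices GG x by exists A.
have fI E : GG E -> E x -> (f E < 2)%N by move=> GE Ex; apply: fI0.
have finj E F : GG E -> E x -> GG F -> F x -> f E = f F -> E = F.
  by move=> GE Ex GF Fx; apply: finj0; rewrite inE.
have := (fI _ GA Ax, fI _ GB Bx, fI _ GD Dx).
have nfAB : f A <> f B by move=> fAB; apply: nAB; apply: finj.
move=> [[fA fB] fD]; have [fDA|fDB] : f D = f A \/ f D = f B by lia.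
  by left; apply: finj.
by right; apply: finj.
Qed.

(** For [x] in a sequence without repetition this is [(-1) ^+ index x c]; it
    vanishes off the sequence. *)
Fixpoint alternating_sign c x : R :=
  if c is y :: c' then if x == y then 1 else - alternating_sign c' x else 0.

Fixpoint alternating_count A c : R :=
  if c is y :: c' then (y \in A)%:R - alternating_count A c' else 0.

Lemma alternating_sign_notin c x : x \notin c -> alternating_sign c x = 0.
Proof.
elim: c => //= y c IH; rewrite inE negb_or => /andP[/negbTE-> /IH->].
exact: oppr0.
Qed.

Lemma alternating_sign_le1 c x : `|alternating_sign c x| <= 1.
Proof. by elim: c => /= [|y c IH]; [|case: eqP]; rewrite ?normr0 ?normr1 ?normrN. Qed.

Lemma sum_alternating_sign A c : uniq c ->
  \sum_(x <- c | x \in A) alternating_sign c x = alternating_count A c.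
Proof.
elim: c => [|y c IH] /=; first by rewrite big_nil.
move=> /andP[yc uc]; rewrite big_cons eqxx -IH// -sumrN.
rewrite [X in if _ then _ + X else X](_ : _ =
  \sum_(x <- c | x \in A) - alternating_sign c x); last first.
  rewrite [LHS]big_seq_cond [RHS]big_seq_cond; apply: eq_bigr => x /andP[xc _].
  by rewrite ifN//; apply: contraNneq yc => <-.
by case: ifP; rewrite ?add0r.
Qed.

Definition both A x y : R := ((x \in A) && (y \in A))%:R.

(** An interior vertex of an admissible path uses different members towards its
    predecessor and towards its successor, and it has no third one.  So a member
    containing it contains exactly one of the two neighbours. *)
Lemma mem_interior_vertex A x y z : cond_g1 GG -> GG A -> edge GG x y -> edge GG y z ->
  ~ common_member GG x y z -> (y \in A)%:R = both A x y + both A y z.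
Proof.
move=> g1 GA /edgeP[_ [B GB [Bx By]]] /edgeP[_ [D GD [Dy Dz]]] nc.
have nBD : B <> D by move=> BD; apply: nc; exists B => //; split=> //; rewrite BD.
rewrite /both; have [yA|] := boolP (y \in A); last by rewrite andbF addr0.
have [xA|xA] := boolP (x \in A); have [zA|zA] := boolP (z \in A);
  rewrite ?addr0 ?add0r//; rewrite ?inE ?notin_setE in yA xA zA.
- by case: nc; exists A.
- by case: (two_members g1 GB GD GA By Dy yA nBD) => eA; subst.
Qed.

(** Along a path the contributions of consecutive interior vertices telescope by
    [mem_interior_vertex]; only the two end edges remain. *)
Lemma alternating_count_path A x s z : cond_g1 GG -> GG A -> s != [::] ->
  path (edge GG) x (rcons s z) -> admissible GG (x :: rcons s z) ->
  alternating_count A s = both A x (head x s) - (-1) ^+ size s * both A (last x s) z.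
Proof.
move=> g1 GA; elim: s x => // y s IH x _ /= /andP[xy pys] adm.
have [s0|s0] := eqVneq s [::].
  move: pys adm; rewrite s0 /= andbT subr0 expr1 => yz adm.
  rewrite (mem_interior_vertex g1 GA xy yz); first by ring.
  exact: (@admissible_triple _ _ [::] _ _ _ [::]).
have adm' : admissible GG (y :: rcons s z) by apply: (@admissible_catl _ _ [:: x]).
rewrite (IH y s0 pys adm').
case: s s0 pys adm {IH adm'} => //= y' s _ /andP[yy' _] adm.
rewrite (mem_interior_vertex g1 GA xy yy'); last first.
  exact: (@admissible_triple _ _ [::] _ _ _ (rcons s z)).
by rewrite !exprS; ring.
Qed.

Lemma alternating_count_rcons A s x :
  alternating_count A (rcons s x) = alternating_count A s + (-1) ^+ size s * (x \in A)%:R.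
Proof.
elim: s => [|y s IH] /=; first by rewrite expr0; ring.
by rewrite IH exprS; ring.
Qed.

(** For the path that runs once around the cycle and repeats its first edge, both
    end edges are the same edge; their contributions cancel since the length is
    even. *)
Lemma alternating_count_cycle A c : cond_g1 GG -> GG A ->
  admissible_cycle GG c -> ~~ odd (size c) -> alternating_count A c = 0.
Proof.
move=> g1 GA [[cyc sz] adm] ev.
case: c cyc sz adm ev => [|x [|y s]]//.
move=> cyc _ adm ev.
have pth : path (edge GG) x (rcons (rcons (y :: s) x) y).
  by rewrite rcons_path last_rcons; apply/andP; split; move: cyc => //= /andP[].
have adm' : admissible GG (x :: rcons (rcons (y :: s) x) y).
  by rewrite -!cats1 -catA; move: adm; rewrite /= take0.
have ne : rcons (y :: s) x != [::] by [].
have := alternating_count_path g1 GA ne pth adm'; rewrite alternating_count_rcons.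
move=> h.
(* The path counts [x] at the end instead of at the beginning, with the same sign. *)
have e1 : (-1) ^+ size (y :: s) = -1 :> R.
  by rewrite -signr_odd; move: ev; rewrite /= negbK => ->.
move: h; rewrite size_rcons exprS e1 last_rcons /=; lra.
Qed.

End Alternating.

(** * Perturbations of a fractional function *)

Section Perturbation.
Context {R : realType} {T : choiceType} (GG : set (set T)) (w : T -> R).
Hypothesis g1 : cond_g1 GG.
Hypothesis w0 : forall x, 0 <= w x.
Hypothesis w1 : forall A, GG A -> (\esum_(x in A) (w x)%:E <= 1)%E.
Implicit Types (x y z p : T) (s c : seq T) (A B D : set T) (eta : T -> R).

(** The bound by [w] keeps the perturbed functions non-negative and inside a
    normal conic set.  In terms of the sum [S] over a member, the change is a
    multiple of the slack [1 - S] by a factor of absolute value at most 1, hence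
    the constraint is preserved, and an equality constraint remains an
    equality. *)
Definition balanced eta :=
  (forall x, `|eta x| <= w x) /\
  forall A S, GG A -> \esum_(x in A) (w x)%:E = S%:E -> exists2 b, `|b| <= 1 &
  forall t, `|t| <= 1 ->
    \esum_(x in A) (w x + t * eta x)%:E = (S + t * b * (1 - S))%:E.

Lemma perturbed_ge0 (a b t : R) : `|b| <= a -> `|t| <= 1 -> 0 <= a + t * b.
Proof.
move=> ba t1; have : `|t * b| <= a.
  by rewrite normrM; apply: le_trans ba; rewrite ler_piMl.
by rewrite ler_norml => /andP[]; lra.
Qed.

Lemma alternating_balanced c : c != [::] -> uniq c ->
  (forall x, x \in c -> 0 < w x) ->
  (forall A, GG A -> alternating_count A c = 0 :> R) ->
  exists2 eta, balanced eta & exists2 x, x \in c & eta x != 0.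
Proof.
move=> c0 uc cw alt0.
(* The amplitude is the minimum of [w] over the sequence, or anything smaller. *)
have [e e0 ew] : exists2 e, 0 < e & forall x, x \in c -> e <= w x.
  elim: c cw {c0 uc alt0} => [|y c IH] cw; first by exists 1.
  have [|e e0 ew] := IH; first by move=> x xc; apply: cw; rewrite inE xc orbT.
  exists (Num.min e (w y)); first by rewrite lt_min e0 cw ?mem_head.
  by move=> x; rewrite inE ge_min => /predU1P[->|/ew->]; rewrite ?lexx ?orbT.
have bound x : `|e * alternating_sign c x| <= w x.
  have [xc|xc] := boolP (x \in c); last by rewrite alternating_sign_notin// mulr0 normr0.
  rewrite normrM gtr0_norm//; apply: le_trans (ew _ xc).
  by rewrite ler_piMr ?alternating_sign_le1// ltW.
exists (fun x => e * alternating_sign c x); last first.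
  case: c c0 {uc cw alt0 ew bound} => // y c _; exists y; first exact: mem_head.
  by rewrite /= eqxx mulr1 gt_eqF.
split=> // A S GA wS; exists 0; first by rewrite normr0.
move=> t t1; rewrite (@esum_change _ _ _ c w _ S)//; last 2 first.
- by move=> x; exact: perturbed_ge0 (bound x) t1.
- by move=> x xc; rewrite alternating_sign_notin// !mulr0 addr0.
congr (_ + _)%:E; rewrite mulr0 mul0r.
under eq_bigr do rewrite addrAC subrr add0r mulrA.
by rewrite -mulr_sumr sum_alternating_sign// alt0// mulr0.
Qed.

Lemma member_pair_le1 A x y : GG A -> A x -> A y -> x <> y -> w x + w y <= 1.
Proof.
move=> GA Ax Ay xy; rewrite -lee_fin; apply: le_trans (w1 GA).
exact: esum_ge_pair.
Qed.

Section Spreading.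
Variable r : T.
Hypothesis r0 : 0 < w r.
Hypothesis r1 : w r < 1.
Let pos x : Prop := 0 < w x.
Let posr : pos r := r0.
Hypothesis noparallel : forall A B x y, GG A -> GG B -> x <> y ->
  pos x -> pos y -> A x -> A y -> B x -> B y -> A = B.
Hypothesis nocycle : forall c, uniq c -> (forall x, x \in c -> pos x) ->
  ~ admissible_cycle GG c.
Local Notation level := (level GG pos r).

Definition parent n x := xget r [set p | level n p /\ edge GG p x].

Definition odds x := w x / (1 - w x).

(** At the vertex closest to [r] in a member, the perturbed value is
    [w p * (1 + f p)]; the remaining terms, of total [S - w p], have to
    compensate.  Multiplying each of them by [1 - f p * odds p] restores the sum
    when [S = 1].  Recursion is on the distance to [r]. *)
Fixpoint spread n x : R :=
  if n is n'.+1 then - (odds (parent n' x) * spread n' (parent n' x)) else 1.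

Definition depth x := xget 0%N [set n | level n x].

Definition factor x : R :=
  if `[< level (depth x) x >] then spread (depth x) x else 0.

Lemma factorE n x : level n x -> factor x = spread n x.
Proof.
move=> lx; rewrite /factor (_ : depth x = n) ?asboolT//.
apply: xget_unique => // m lm; exact: level_inj lm lx.
Qed.

Lemma factor0 x : ~ (exists n, level n x) -> factor x = 0.
Proof. by move=> nl; rewrite /factor asboolF// => lx; apply: nl; exists (depth x). Qed.

Lemma parentE n x p : level n.+1 x -> level n p -> edge GG p x -> parent n x = p.
Proof.
move=> lx lp px; apply: xget_unique => //= q [lq qx].
exact: (parent_unique posr noparallel nocycle lx lq lp qx px).
Qed.

Lemma edge_le1 x y : edge GG x y -> w x + w y <= 1.
Proof. by move=> /edgeP[xy [A GA [Ax Ay]]]; apply: member_pair_le1 Ay xy. Qed.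

Lemma level_lt1 n x : level n x -> w x < 1.
Proof.
case: n => [[/= -> _]//|n] lx; have [p lp px] := level_parent lx.
have := edge_le1 px; have : 0 < w p := level_pos posr lp; lra.
Qed.

Lemma odds_ge0 n x : level n x -> 0 <= odds x.
Proof. by move=> /level_lt1 x1; rewrite divr_ge0// subr_ge0 ltW. Qed.

(** [w x / (1 - w x)] increases with [w x], and [w y <= 1 - w x]. *)
Lemma odds_edge m n x y : level m x -> level n y -> edge GG x y ->
  odds x * odds y <= 1.
Proof.
move=> /level_lt1 lx /level_lt1 ly /edge_le1 xy.
rewrite mulf_div ler_pdivrMr ?mulr_gt0 ?subr_gt0// mul1r.
by have := w0 x; have := w0 y; nra.
Qed.

(** The starting value 1 and the first ratio [odds r] are both below this. *)
Definition spread_bound := 1 + odds r.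

Lemma level_root : level 0 r. Proof. by split. Qed.

(** The second estimate is what the induction needs: one step replaces [spread]
    by [odds p * spread], and the next step multiplies this by [odds x], for a
    neighbour [x] of [p]. *)
Lemma spread_le n x : level n x ->
  `|spread n x| <= spread_bound /\ odds x * `|spread n x| <= spread_bound.
Proof.
have or0 := odds_ge0 level_root.
elim: n x => [|n IH] x lx /=.
  by case: lx => -> _; rewrite normr1 mulr1 /spread_bound; split; lra.
have [p lp px] := level_parent lx; rewrite (parentE lx lp px).
have [b1 b2] := IH p lp; rewrite normrN normrM (ger0_norm (odds_ge0 lp)).
split=> //; rewrite mulrA; apply: le_trans b1; rewrite ler_piMl//.
by rewrite mulrC (odds_edge lp lx px).
Qed.

(** The vertex [p] closest to [r] is the parent of all other vertices of [A] with
    positive weight, which therefore share one factor. *)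
Lemma factor_member A : GG A -> (exists2 x, A x & exists n, level n x) ->
  exists p, [/\ A p, w p < 1, `|factor p| <= spread_bound, odds p * `|factor p| <= spread_bound &
    forall x, A x -> x <> p -> 0 < w x -> factor x = - (odds p * factor p)].
Proof.
move=> GA [x0 Ax0 [n0 lx0]].
pose P n := `[< exists2 x, A x & level n x >].
have exP : exists n, P n by exists n0; apply/asboolP; exists x0.
have [n /asboolP[p Ap lp] minn] := ex_minnP exP.
have low j q : (j < n)%N -> level j q -> ~ A q.
  move=> jn lq Aq; have := minn j; rewrite leqNgt jn => /(_ _) mj.
  by suff /mj : P j by []; apply/asboolP; exists q.
exists p; rewrite (factorE lp); have [b1 b2] := spread_le lp.
split=> //; first exact: level_lt1 lp.
move=> x Ax xp x0'; have px : edge GG p x.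
  by apply/edgeP; split; [exact/nesym|exists A].
have [m mn lx] := level_reach lp px x0'.
have mE : m = n.+1.
  have nm : (n <= m)%N by rewrite leqNgt; apply/negP => /low /(_ lx).
  have [|//] : m = n \/ m = n.+1 by lia.
  move=> {}mn; rewrite mn in lx; case: xp.
  exact: (min_level_unique posr noparallel nocycle GA Ax Ap lx lp low).
by subst m; rewrite (factorE lx) /= (parentE lx lp px).
Qed.

Lemma spread_balanced : exists2 eta, balanced eta & eta r != 0.
Proof.
have or0 := odds_ge0 level_root; have C0 : 0 < spread_bound by rewrite /spread_bound; lra.
have fle x : `|factor x| <= spread_bound.
  have [[n lx]|nl] := pselect (exists n, level n x).
    by rewrite (factorE lx); have [] := spread_le lx.
  by rewrite factor0// normr0 ltW.
(* Dividing by the bound makes [|eta| <= w]. *)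
pose eta x := spread_bound^-1 * factor x * w x.
have etale x : `|eta x| <= w x.
  rewrite /eta !normrM (ger0_norm (w0 x)) gtr0_norm ?invr_gt0//.
  by rewrite ler_piMl// mulrC ler_pdivrMr// mul1r.
exists eta; last first.
  by rewrite /eta (factorE level_root)/= mulr1 mulf_neq0 ?invr_eq0 ?gt_eqF.
split=> // A S GA wS.
have [ex|nex] := pselect (exists2 x, A x & exists n, level n x); last first.
  exists 0; first by rewrite normr0.
  move=> t t1; rewrite mulr0 mul0r addr0 -wS; apply: eq_esum => x Ax.
  rewrite /eta factor0; first by rewrite mulr0 mul0r mulr0 addr0.
  by move=> xl; apply: nex; exists x.
have [p [Ap p1 fp ofp fx]] := factor_member GA ex.
have op0 : 0 <= odds p by rewrite divr_ge0// subr_ge0 ltW.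
have b1 : `|spread_bound^-1 * (odds p * factor p)| <= 1.
  rewrite normrM (gtr0_norm (x := spread_bound^-1)) ?invr_gt0// mulrC.
  by rewrite ler_pdivrMr// mul1r normrM ger0_norm.
exists (spread_bound^-1 * (odds p * factor p)) => // t t1.
set b := (X in `|X| <= 1) in b1 *.
have tb : `|t * b| <= 1 by rewrite normrM mulr_ile1.
rewrite (@esum_affine _ _ A p w _ (1 - t * b) S)//.
- congr EFin; rewrite /eta.
  have -> : spread_bound^-1 * factor p * w p = b * (1 - w p).
    by rewrite /b /odds; field; rewrite !gt_eqF ?subr_gt0//.
  by rewrite -/b; ring.
- by move=> x; exact: perturbed_ge0 (etale x) t1.
- by move: tb; rewrite ler_norml => /andP[]; lra.
- move=> x Ax xp; rewrite /eta; have := w0 x; rewrite le_eqVlt.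
  move=> /predU1P[<-|wx]; first by rewrite !mulr0 addr0.
  by rewrite (fx x)// /b; ring.
Qed.

End Spreading.

Hypothesis g2 : cond_g2 GG.

Lemma exists_balanced r : vertices GG r -> 0 < w r -> w r < 1 ->
  exists2 eta, balanced eta & exists2 x, vertices GG x & eta x != 0.
Proof.
move=> vr r0 r1.
have [[A [B [x [y [GA GB [xy AB] [x0 y0] [[Ax Ay] [Bx By]]]]]]]|np] := pselect
    (exists A B x y, [/\ GG A, GG B, x <> y /\ A <> B, 0 < w x /\ 0 < w y &
      (A x /\ A y) /\ B x /\ B y]).
  have [| | | |eta beta [z zc ez]] := @alternating_balanced [:: x; y].
  - by [].
  - by rewrite /= inE andbT; apply/eqP.
  - by move=> z; rewrite !inE => /orP[] /eqP->.
  - move=> D GD /=; have -> : (x \in D) = (y \in D) by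
      apply/idP/idP; rewrite !inE => Dz;
      [case: (two_members g1 GA GB GD Ax Bx Dz AB) => ->
      |case: (two_members g1 GA GB GD Ay By Dz AB) => ->].
    by ring.
  exists eta => //; exists z => //.
  by move: zc; rewrite !inE => /orP[] /eqP->; exists A.
have [[c [uc c0 cyc]]|nc] := pselect (exists c,
    [/\ uniq c, forall x, x \in c -> 0 < w x & admissible_cycle GG c]).
  have [| | | |eta beta [z zc ez]] := @alternating_balanced c => //.
  - by case: cyc => -[_]; case: (c).
  - by move=> A GA; apply: (alternating_count_cycle g1 GA cyc); apply: g2.
  exists eta => //; exists z => //.
  case: cyc => -[/(fun h => next_cycle h zc) + _] _.
  by rewrite edge_sym => /edge_vertex.
have [||eta beta er] := @spread_balanced r r0 r1.
- move=> A B x y GA GB xy x0 y0 Ax Ay Bx By; apply: contrapT => AB.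
  by apply: np; exists A, B, x, y.
- by move=> c uc c0 cyc; apply: nc; exists c.
by exists eta => //; exists r.
Qed.

End Perturbation.

(** * Extreme points *)

Section Extension.
Context {R : realType} {T : choiceType} {GG : set (set T)}.
Implicit Types (w : fun_space R GG) (u : T -> R) (A : set T).

(** Functions on the vertex subtype are extended by 0 to the ambient type, where
    the members of the family live and paths are taken. *)
Definition extend w (x : T) : R :=
  if pselect (vertices GG x) is left vx then w (SigSub (mem_set vx)) else 0.

Lemma extend_val w v : extend w (val v) = w v.
Proof.
rewrite /extend; case: pselect => [vx|[]]; last exact: set_valP.
by congr w; apply: val_inj.
Qed.

Lemma extend_ge0 w : (forall v, 0 <= w v) -> forall x, 0 <= extend w x.
Proof. by move=> w0 x; rewrite /extend; case: pselect. Qed.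

Lemma sum_over_val A u : GG A ->
  sum_over A ((fun v => u (val v)) : fun_space R GG) = \esum_(x in A) (u x)%:E.
Proof.
move=> GA; rewrite /sum_over 
  (@reindex_esum _ _ _ [set v : set_type (vertices GG) | A (val v)] A val)//.
split=> //; first by move=> x y _ _; exact: val_inj.
move=> x Ax; have vx : vertices GG x by exists A.
by exists (SigSub (mem_set vx)).
Qed.

Lemma sum_over_extend A w : GG A ->
  sum_over A w = \esum_(x in A) (extend w x)%:E.
Proof.
move=> GA; rewrite -sum_over_val//; congr sum_over.
by apply/funext => v; rewrite extend_val.
Qed.

Lemma stable_le1 GG1 w v : stable R GG GG1 w -> w v <= 1.
Proof.
move=> [w0 w1 _]; have [A GA Av] : vertices GG (val v) by exact: set_valP.
have := w1 A GA; rewrite sum_over_extend//.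
rewrite (esum_pick Av (extend_ge0 w0)) extend_val -lee_fin.
by apply: le_trans; rewrite leeDl// esum_ge0// => x _; rewrite lee_fin extend_ge0.
Qed.

Lemma extreme_stable01 GG1 (V : set (fun_space R GG)) w :
  stable01 R GG GG1 w -> V w -> extreme_points (stable R GG GG1 `&` V) w.
Proof.
move=> [ws w01] Vw; split=> // -[y [z [t [[[ys _] yw] [[zs _] zw] /andP[t0 t1] wE]]]].
have yz v : w v = t * y v + (1 - t) * z v by rewrite [in LHS]wE.
have [t_0|tn0] := eqVneq t 0.
  by apply: zw; apply/funext => v; rewrite yz t_0; ring.
apply: yw; apply/funext => v.
have y1 := stable_le1 v ys; have z1 := stable_le1 v zs.
have [y0 _ _] := ys; have [z0 _ _] := zs.
have := y0 v; have := z0 v; have := yz v.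
have tp : 0 < t by rewrite lt_def tn0.
by have [->|->] := w01 v; nra.
Qed.

Lemma perturbed_stable GG1 (eta : T -> R) w t : GG1 `<=` GG -> stable R GG GG1 w ->
  balanced GG (extend w) eta -> `|t| <= 1 ->
  stable R GG GG1 (fun v => w v + t * eta (val v)).
Proof.
move=> sub [w0 w1 w1'] [le_eta bal] t1.
have sumE A S : GG A -> sum_over A w = S%:E -> exists2 b, `|b| <= 1 &
    sum_over A ((fun v => w v + t * eta (val v)) : fun_space R GG) =
    (S + b * (1 - S))%:E.
  move=> GA; rewrite sum_over_extend// => wS.
  have [b b1 bE] := bal A S GA wS; exists (t * b).
    by rewrite normrM mulr_ile1.
  rewrite -bE// -sum_over_val//; congr sum_over.
  by apply/funext => v; rewrite extend_val.
split=> [v|A GA|A GA].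
- by rewrite -extend_val; exact: perturbed_ge0.
- have := w1 A GA; have : (0 <= sum_over A w)%E.
    by rewrite /sum_over esum_ge0// => v _; rewrite lee_fin.
  case E : (sum_over A w) => [S| |]// S0; rewrite lee_fin => S1.
  have [b + ->] := sumE A S GA E.
  by rewrite lee_fin ler_norml => /andP[]; nra.
- have [b _ ->] := sumE A 1 (sub _ GA) (w1' A GA).
  by rewrite subrr mulr0 addr0.
Qed.

End Extension.

Theorem theorem2p4 (R : realType) (T : choiceType) (GG GG1 : set (set T))
    (V : set (fun_space R GG)) :
  countable GG ->
  (forall A, GG A -> countable A) ->
  cond_g1 GG ->
  cond_g2 GG ->
  GG1 `<=` GG ->
  normal_set V ->
  conic_set V ->
  extreme_points (stable R GG GG1 `&` V) = stable01 R GG GG1 `&` V.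
Proof.
move=> _ _ g1 g2 sub normV conV; apply/seteqP; split; last first.
  by move=> w [w01 Vw]; exact: extreme_stable01.
move=> w [[ws Vw] ext]; split=> //; split=> // v.
apply: contrapT => /not_orP[wv0 wv1]; apply: ext.
have [w0 wle1 _] := ws.
have W0 := extend_ge0 w0.
have W1 A : GG A -> (\esum_(x in A) (extend w x)%:E <= 1)%E.
  by move=> GA; rewrite -sum_over_extend//; exact: wle1.
have [||eta beta [x vx ex]] := exists_balanced g1 W0 W1 g2 (set_valP v).
- by rewrite extend_val lt_def w0 andbT; apply/eqP.
- by rewrite extend_val lt_def (stable_le1 v ws) andbT; apply/eqP/nesym.
have pert t : `|t| <= 1 -> V (fun v => w v + t * eta (val v)).
  move=> t1; apply: (normV _ (2 *: w)); first exact: conV.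
  move=> u; have [/(_ (val u)) + _] := beta; rewrite extend_val => eu.
  have w2 : 0 <= w u := w0 u.
  rewrite [X in _ <= `|X|](_ : _ = 2 * w u)// [`|2 * _|]ger0_norm ?mulr_ge0//.
  apply: le_trans (ler_normD _ _) _; rewrite normrM (ger0_norm w2).
  rewrite mulr_natl mulr2n lerD2l.
  by apply: le_trans eu; rewrite ler_piMl.
have neq t : t != 0 -> (fun v => w v + t * eta (val v)) <> w.
  move=> t0 /(congr1 (fun f => f (SigSub (mem_set vx)))) /= h.
  by have /eqP := mulf_neq0 t0 ex; apply; apply: (addrI (w (SigSub (mem_set vx)))); rewrite addr0.
exists (fun v => w v + 1 * eta (val v)), (fun v => w v + (- 1) * eta (val v)), 2^-1.
have n1 : `|1 : R| <= 1 by rewrite normr1.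
have n2 : `|(- 1) : R| <= 1 by rewrite normrN1.
split.
- split; [split; [exact: perturbed_stable|exact: pert]|exact/neq/oner_neq0].
- split; [split; [exact: perturbed_stable|exact: pert]|].
  by apply: neq; rewrite oppr_eq0 oner_neq0.
- lra.
- apply/funext => u.
  rewrite [RHS](_ : _ = 2^-1 * (w u + 1 * eta (val u)) +
    (1 - 2^-1) * (w u + (- 1) * eta (val u)))//.
  by field.
Qed.
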